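(* Let $n,r$ be non-negative integers with $0\leq r\leq 2n+1$ and define $$A_{n,r}:=(-1)^{r+1}\sum_{p=0}^n\sum_{\ell=0}^n (-2)^{p-\ell}\binom{r}{n-\ell}\binom{2n+1-r}{p}\binom{n-p+\ell}{\ell}.$$ Then $$A_{n,r}=\begin{cases}-2^n,&0\leq r\leq n,\\ 2^n,&n+1\leq r\leq 2n+1.\end{cases}$$
   Context: Binomial coefficients are the usual ones for non-negative integers, with $\binom{a}{b}=0$ if $a<b$. *)

(* Defs.v *)
From mathcomp Require Import all_boot all_order all_algebra.

Set Implicit Arguments.
Unset Strict Implicit.
Unset Printing Implicit Defensive.

Import GRing.Theory Num.Theory.
Local Open Scope ring_scope.

(* The power of -2 has an integer (possibly negative) exponent, hence the
   values in rat.  The natural-number subtractions n - l, n - p and 2n+1 - r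
   are exact in the ranges l <= n, p <= n, r <= 2n+1. *)
Definition A (n r : nat) : rat :=
  (-1) ^+ r.+1 *
  \sum_(0 <= p < n.+1) \sum_(0 <= l < n.+1)
    (- 2) ^ (p%:Z - l%:Z) *
    ('C(r, n - l))%:R * ('C(2 * n + 1 - r, p))%:R * ('C(n - p + l, l))%:R.

(* Main.v *)
Require Import Defs.
From mathcomp Require Import all_boot all_order all_algebra.
From mathcomp Require Import zify ring.

(** Write [x^a y^b] F for the coefficient of x^a y^b in F.  Since
    'C(i + j, i) = [x^i y^j] 1 / (1 - x - y), the substitution l -> n - l turns
    the double sum into (-2)^(-n) S(2n + 1 - r, r), where
      S(m, r) = [x^n y^n] (1 - 2x)^m (1 - 2y)^r / (1 - x - y).
    The identity (1 - 2x) + (1 - 2y) = 2 (1 - x - y) cancels the denominator: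
      S(m + 1, r) + S(m, r + 1) = 2 [x^n y^n] (1 - 2x)^m (1 - 2y)^r
                                = 2 * 4^n 'C(m, n) 'C(r, n).
    When m + r = 2n the right-hand side vanishes, except for m = r = n.  So
    S(2n + 1 - r, r) changes sign at each step of r below n, while at r = n the
    symmetry S(n + 1, n) = S(n, n + 1) gives S(n + 1, n) = 4^n.  This determines
    S for r <= n, and symmetry gives the values for r > n.

    Power series are represented by their coefficient sequences, and the
    functional (f, g) |-> [x^n y^n] f(x) g(y) / (1 - x - y) by an explicit
    finite sum, [diag_coef]; multiplication by the variable is [shift].  The
    cancellation of the denominator is [diag_coef_cancel], which is Pascal's
    rule, and the recurrence for S is [diag_coef_pow_rec]. *)

Import GRing.Theory Num.Theory.
Local Open Scope ring_scope.

Section DiagonalCoefficient.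

Set Implicit Arguments.
Unset Strict Implicit.

Variable R : comNzRingType.
Implicit Types f g h : nat -> R.

Definition shift f (i : nat) : R := if i is k.+1 then f k else 0.

Definition diag_coef (n : nat) f g : R :=
  \sum_(0 <= i < n.+1) \sum_(0 <= j < n.+1)
    f i * g j * 'C((n - i) + (n - j), n - i)%:R.

Lemma eq_diag_coef n f f' g g' :
  f =1 f' -> g =1 g' -> diag_coef n f g = diag_coef n f' g'.
Proof.
move=> ff' gg'; apply: eq_bigr => i _; apply: eq_bigr => j _.
by rewrite ff' gg'.
Qed.

Lemma diag_coefC n f g : diag_coef n f g = diag_coef n g f.
Proof.
rewrite /diag_coef exchange_big /=; apply: eq_bigr => i _; apply: eq_bigr => j _.
rewrite [f j * _]mulrC; congr (_ * _%:R).
by rewrite -bin_sub ?leq_addr // addKn addnC.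
Qed.

Lemma diag_coef_subl n c f h g :
  diag_coef n (fun i => f i - c * h i) g
  = diag_coef n f g - c * diag_coef n h g.
Proof.
rewrite /diag_coef mulr_sumr -sumrB; apply: eq_bigr => i _.
rewrite mulr_sumr -sumrB; apply: eq_bigr => j _; ring.
Qed.

Lemma sum_shift n f h :
  \sum_(0 <= i < n.+1) shift f i * h i
  = \sum_(0 <= i < n.+1) f i * (h i.+1 *+ (i < n)%N).
Proof.
rewrite big_nat_recl // big_nat_recr //= mul0r add0r ltnn mulr0n mulr0 addr0.
by apply: eq_big_nat => i /andP[_ ->].
Qed.

(** Multiplying f(x) g(y) / (1 - x - y) by 1 - x - y leaves f(x) g(y): the three
    terms combine coefficientwise by Pascal's rule, which fails only at the
    corner i = j = n, where 'C(0, 0) = 1 has no predecessors. *)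
Lemma diag_coef_cancel n f g :
  diag_coef n f g - diag_coef n (shift f) g - diag_coef n f (shift g)
  = f n * g n.
Proof.
pose w i j : R := 'C((n - i) + (n - j), n - i)%:R.
have shl : diag_coef n (shift f) g = \sum_(0 <= i < n.+1) \sum_(0 <= j < n.+1)
    f i * g j * (w i.+1 j *+ (i < n)%N).
  rewrite /diag_coef.
  under eq_bigr => i _ do under eq_bigr => j _ do rewrite -mulrA.
  under eq_bigr => i _ do rewrite -mulr_sumr.
  rewrite sum_shift; apply: eq_bigr => i _.
  rewrite -sumrMnl mulr_sumr; apply: eq_bigr => j _.
  by rewrite -mulrnAr mulrA.
have shr : diag_coef n f (shift g) = \sum_(0 <= i < n.+1) \sum_(0 <= j < n.+1)
    f i * g j * (w i j.+1 *+ (j < n)%N).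
  apply: eq_bigr => i _.
  under eq_bigr => j _ do rewrite -mulrA.
  rewrite -mulr_sumr sum_shift mulr_sumr; apply: eq_bigr => j _.
  by rewrite mulrA.
have pascal i j : (i <= n)%N -> (j <= n)%N ->
    w i j - w i.+1 j *+ (i < n)%N - w i j.+1 *+ (j < n)%N
    = ((i == n) && (j == n))%:R.
  rewrite /w; case: (ltngtP i n) => // [lt_in|->] _;
    case: (ltngtP j n) => // [lt_jn|->] _;
    rewrite ?subnn ?bin0 ?addn0 ?binn ?mulr0n ?mulr1n ?subr0 ?subrr //.
  by rewrite -(subnSK lt_in) -(subnSK lt_jn) addSn binS addSnnS natrD; ring.
rewrite shl shr /diag_coef -!sumrB.
transitivity (\sum_(0 <= i < n.+1) \sum_(0 <= j < n.+1)
                 f i * g j * ((i == n) && (j == n))%:R).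
  apply: eq_big_nat => i /andP[_ lein]; rewrite -!sumrB.
  by apply: eq_big_nat => j /andP[_ lejn]; rewrite -pascal // !mulrBr.
rewrite big_nat_recr //= big1_seq ?add0r; last first.
  move=> i /andP[_]; rewrite mem_index_iota => /andP[_ lt_in].
  by rewrite big1 // => j _; rewrite (ltn_eqF lt_in) mulr0.
rewrite big_nat_recr //= big1_seq ?add0r ?eqxx ?mulr1 //.
move=> j /andP[_]; rewrite mem_index_iota => /andP[_ lt_jn].
by rewrite (ltn_eqF lt_jn) andbF mulr0.
Qed.

(** The coefficient sequence of (1 - 2x)^m. *)
Definition pow_coef (m i : nat) : R := (- 2) ^+ i * 'C(m, i)%:R.

Lemma pow_coefS m :
  pow_coef m.+1 =1 (fun i => pow_coef m i - 2 * shift (pow_coef m) i).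
Proof.
case=> [|i]; rewrite /pow_coef /= ?bin0; first by rewrite mulr0 subr0.
by rewrite binS natrD exprS; ring.
Qed.

Lemma diag_coef_pow_rec n m r :
  diag_coef n (pow_coef m.+1) (pow_coef r)
    + diag_coef n (pow_coef m) (pow_coef r.+1)
  = 2 * (pow_coef m n * pow_coef r n).
Proof.
rewrite -diag_coef_cancel (eq_diag_coef _ (pow_coefS m) (frefl _)) diag_coef_subl.
rewrite [diag_coef _ _ (pow_coef r.+1)]diag_coefC.
rewrite (eq_diag_coef _ (pow_coefS r) (frefl _)) diag_coef_subl.
rewrite [diag_coef _ (pow_coef r) _]diag_coefC.
rewrite [diag_coef _ (shift (pow_coef r)) _]diag_coefC; ring.
Qed.

End DiagonalCoefficient.

Arguments pow_coef {R}.

(** The induction is on k = n - r, starting from r = n, where symmetry makes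
    the two terms of the recurrence equal; division by 2 is needed there.  The
    value (-1)^(n - r) 4^n is split so that the prefactor (-2)^(-n) cancels. *)
Lemma diag_coef_pow_low n r k : (r + k)%N = n ->
  diag_coef n (pow_coef (n + k).+1) (pow_coef r)
  = (-1) ^+ r * ((-2) ^+ n * 2 ^+ n) :> rat.
Proof.
elim: k r => [|k IHk] r.
  rewrite addn0 => ->; rewrite addn0.
  have pow_nn : pow_coef n n = (-2) ^+ n :> rat by rewrite /pow_coef binn mulr1.
  have := diag_coef_pow_rec rat n n n; rewrite pow_nn.
  rewrite [diag_coef _ _ (pow_coef n.+1)]diag_coefC -mulr2n -[_ *+ 2]mulr_natl.
  by move/mulfI => -> //; rewrite {1}exprNn; ring.
move=> rkn.
have := diag_coef_pow_rec rat n (n + k.+1) r.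
rewrite [pow_coef r n]/pow_coef bin_small; last by lia.
rewrite !mulr0 addnS IHk; last by lia.
by move/eqP; rewrite addr_eq0 => /eqP ->; rewrite exprS mulN1r mulNr opprK.
Qed.

Lemma A_diag_coef n r :
  A n r = (-1) ^+ r.+1 / (-2) ^+ n
          * diag_coef n (pow_coef (2 * n + 1 - r)) (pow_coef r).
Proof.
rewrite /A -mulrA; congr (_ * _).
rewrite /diag_coef mulr_sumr; apply: eq_big_nat => p /andP[_ le_pn].
rewrite big_nat_rev mulr_sumr; apply: eq_big_nat => j /andP[_ le_jn].
rewrite add0n subSS subKn // -[X in _ * X%:R]bin_sub ?leq_addl // addnK.
have -> : p%:Z - (n - j)%:Z = p%:Z + j%:Z - n%:Z by lia.
rewrite !expfzDr // -exprnN -!exprnP /pow_coef; ring.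
Qed.

Theorem proposition4p1 (n r : nat) (hr : (r <= 2 * n + 1)%N) :
  ((r <= n)%N -> A n r = - 2 ^+ n) /\
  ((n + 1 <= r)%N -> A n r = 2 ^+ n).
Proof.
have cancel (e m : nat) :
    (-1) ^+ e / (-2) ^+ n * ((-1) ^+ m * ((-2) ^+ n * 2 ^+ n))
    = (-1) ^+ (e + m) * 2 ^+ n :> rat.
  by rewrite mulrACA -exprD mulKf ?expf_neq0.
rewrite A_diag_coef; split=> [le_rn | lt_nr].
  have -> : (2 * n + 1 - r)%N = (n + (n - r)).+1 by lia.
  rewrite diag_coef_pow_low ?subnKC // cancel.
  by rewrite -signr_odd addSn addnn /= odd_double mulN1r.
rewrite diag_coefC.
(* Naming m lets r be rewritten in terms of m without a circularity. *)
have [m def_m] : exists m, m = (2 * n + 1 - r)%N by eexists.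
have def_r : r = (n + (n - m)).+1 by lia.
rewrite -def_m {2}def_r diag_coef_pow_low; last by lia.
rewrite cancel; have -> : (r.+1 + m)%N = n.+1.*2 by lia.
by rewrite -signr_odd odd_double mul1r.
Qed.
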